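(* Let $\mathcal{Z}$ be the set of bounded random variables on a standard atomless probability space $(\Omega,\mathcal{F},P)$, equipped with the norm topology of $\mathcal{L}_1(\Omega,\mathcal{F},P)$. If the total preorder $\succeq$ on $\mathcal{Z}$ is law invariant, continuous, monotonic, and satisfies the dual independence axiom for random variables, then there exists a bounded, nondecreasing, continuous function $w:[0,1]\to\mathbb{R}_+$ such that $$U(Z)=\int_0^1F_Z^{-1}(p)\,dw(p),\qquad Z\in\mathcal{Z},$$ is a numerical representation of $\succeq$.
   Context: $F_Z$ is the distribution function of $Z$ and $F_Z^{-1}(p)=\inf\{t:F_Z(t)\ge p\}$ its quantile function. Law invariant: equal distributions imply indifference. Continuous: for each $Z$ the sets $\{V:V\succeq Z\}$ and $\{V:Z\succeq V\}$ are closed in $\mathcal{L}_1$. Monotonic: $Z\ge V$ a.s. implies $Z\succeq V$. $Z,V$ comonotonic means $(Z(\omega)-Z(\omega'))(V(\omega)-V(\omega'))\ge0$ for all $\omega,\omega'$. Dual independence axiom for random variables: for all comonotonic $Z,V,W$, $Z\succ V$ implies $\alpha Z+(1-\alpha)W\succ\alpha V+(1-\alpha)W$ for all $\alpha\in(0,1)$. A total preorder is reflexive, transitive, complete; $\succ$ its strict part; $U$ is a numerical representation if $Z\succ V\iff U(Z)>U(V)$. *)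

(* Defs.v *)
From HB Require Import structures.
From mathcomp Require Import all_boot all_order all_algebra.
From mathcomp Require Import all_classical all_reals all_analysis.

Import Order.TTheory GRing.Theory Num.Theory.
Import numFieldNormedType.Exports.
Local Open Scope classical_set_scope.
Local Open Scope ring_scope.

Section Defs.
Context {d : measure_display} {T : measurableType d} {R : realType}.
Variable P : probability T R.

Definition atomless : Prop :=
  forall A : set T, measurable A -> (0 < P A)%E ->
    exists B : set T, [/\ measurable B, B `<=` A & (0 < P B < P A)%E].

Definition bounded_rv (Z : T -> R) : Prop :=
  measurable_fun setT Z /\ exists M : R, forall x, `|Z x| <= M.

Definition L1dist (Z V : T -> R) : \bar R := (\int[P]_x (`|Z x - V x|)%:E)%E.

Definition L1_closed_in_Z (S : (T -> R) -> Prop) : Prop :=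
  forall V, bounded_rv V ->
    (forall e : R, 0 < e -> exists V', S V' /\ bounded_rv V' /\ (L1dist V V' < e%:E)%E) ->
    S V.

Definition same_law (Z V : T -> R) : Prop :=
  forall B : set R, measurable B -> P (Z @^-1` B) = P (V @^-1` B).

Definition cdf (Z : T -> R) (t : R) : \bar R := P [set x | Z x <= t].
Definition quantile (Z : T -> R) (p : R) : R :=
  inf [set t : R | (p%:E <= cdf Z t)%E].

Definition comonotonic (Z V : T -> R) : Prop :=
  forall w w' : T, 0 <= (Z w - Z w') * (V w - V w').

Variable pref : (T -> R) -> (T -> R) -> Prop.

Definition spref (Z V : T -> R) : Prop := pref Z V /\ ~ pref V Z.

Definition total_preorder_on_Z : Prop :=
  [/\ (forall Z, bounded_rv Z -> pref Z Z),
      (forall Z V W, bounded_rv Z -> bounded_rv V -> bounded_rv W ->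
          pref Z V -> pref V W -> pref Z W)
    & (forall Z V, bounded_rv Z -> bounded_rv V -> pref Z V \/ pref V Z)].

Definition law_invariant : Prop :=
  forall Z V, bounded_rv Z -> bounded_rv V -> same_law Z V -> pref Z V /\ pref V Z.

Definition pref_continuous : Prop :=
  forall Z, bounded_rv Z ->
    L1_closed_in_Z (fun V => bounded_rv V /\ pref V Z) /\
    L1_closed_in_Z (fun V => bounded_rv V /\ pref Z V).

Definition pref_monotonic : Prop :=
  forall Z V, bounded_rv Z -> bounded_rv V ->
    {ae P, forall x, V x <= Z x} -> pref Z V.

Definition dual_independence : Prop :=
  forall Z V W, bounded_rv Z -> bounded_rv V -> bounded_rv W ->
    comonotonic Z V -> comonotonic Z W -> comonotonic V W ->
    spref Z V ->
    forall a : R, 0 < a < 1 ->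
      spref (fun x => a * Z x + (1 - a) * W x) (fun x => a * V x + (1 - a) * W x).

Definition numerical_representation (U : (T -> R) -> \bar R) : Prop :=
  forall Z V, bounded_rv Z -> bounded_rv V -> (spref Z V <-> (U V < U Z)%E).

End Defs.

(* integral of a quantile function against dw(p) over [0,1] (the Lebesgue-
   Stieltjes measure of the continuous w; the point 0 is negligible) *)
Definition dual_utility {d} {T : measurableType d} {R : realType}
  (P : probability T R) (w : cumulative R R) (Z : T -> R) : \bar R :=
  (\int[lebesgue_stieltjes_measure w]_(p in `]0%R, 1%R]%classic) (quantile P Z p)%:E)%E.

(* Main.v *)
(** Unless all constants are indifferent (and then, by monotonicity, so is
    everything), dual independence makes constants strictly ordered, and by
    continuity every bounded [Z] is indifferent to a unique constant [CE Z].
    The functional [CE] is monotone, law invariant, [L1]-continuous, positively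
    homogeneous and additive on comonotonic variables. Since [P] is atomless,
    sets of every measure exist, so [CE \1_A = 1 - w (1 - P A)] defines [w] on
    the whole of [[0, 1]]; it is continuous because [CE] is.

    Approximate [Z] within [dl] by the staircase
    [- M + dl * \sum_i \1_(- M + i dl < Z)]. Its terms are comonotonic, so its
    certainty equivalent is [- M + dl * \sum_i (1 - w (F_Z (- M + i dl)))]. As
    [F_Z^-1 p > t] iff [p > F_Z t], this is also the [dw]-integral of the same
    staircase composed with the quantile function, so [CE Z] and
    [\int F_Z^-1 dw] differ by at most [2 dl]. *)
Require Import Defs.
From HB Require Import structures.
From mathcomp Require Import all_boot all_order all_algebra.
From mathcomp Require Import all_classical all_reals all_analysis measurable_realfun.
From mathcomp Require Import ring lra.
Import Order.TTheory GRing.Theory Num.Theory.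
Import numFieldNormedType.Exports.
Local Open Scope classical_set_scope.
Local Open Scope ring_scope.

(** * Bounded random variables, comonotonicity and [L1] distances *)

Section bounded_random_variables.
Context {d : measure_display} {T : measurableType d} {R : realType}.
Variable P : probability T R.
Implicit Types (Z V W : T -> R) (A B : set T).

Lemma bounded_rv_cst (c : R) : bounded_rv (cst c : T -> R).
Proof. by split => //; exists `|c|. Qed.

Lemma bounded_rvD Z V : bounded_rv Z -> bounded_rv V ->
  bounded_rv (fun x => Z x + V x).
Proof.
move=> [mZ [M hM]] [mV [N hN]]; split; first exact: measurable_funD.
by exists (M + N) => x; rewrite (le_trans (ler_normD _ _))// lerD.
Qed.

Lemma bounded_rvZ (a : R) Z : bounded_rv Z -> bounded_rv (fun x => a * Z x).
Proof.
move=> [mZ [M hM]]; split; first exact: measurable_funM.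
by exists (`|a| * M) => x; rewrite normrM ler_wpM2l.
Qed.

Lemma bounded_rv_indic A : measurable A -> bounded_rv (\1_A : T -> R).
Proof.
move=> mA; split; first exact: measurable_indic.
by exists 1 => x; rewrite indicE; case: (x \in A); rewrite ?normr1 ?normr0.
Qed.

Lemma comonotonic_comp Z (f h : R -> R) :
  {homo f : x y / x <= y} -> {homo h : x y / x <= y} ->
  comonotonic (f \o Z) (h \o Z).
Proof.
move=> ndf ndh w w'; have [le|/ltW le] := leP (Z w) (Z w').
  by rewrite mulr_le0 ?subr_le0 ?ndf ?ndh.
by rewrite mulr_ge0 ?subr_ge0 ?ndf ?ndh.
Qed.

Lemma comonotonic_cstr Z (c : R) : comonotonic Z (cst c).
Proof. by move=> w w'; rewrite /= subrr mulr0. Qed.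

Lemma comonotonic_cstl Z (c : R) : comonotonic (cst c) Z.
Proof. by move=> w w'; rewrite /= subrr mul0r. Qed.

Lemma comonotonic_addcr Z V (c : R) :
  comonotonic Z V -> comonotonic Z (fun x => V x + c).
Proof. by move=> h w w' /=; rewrite opprD addrACA subrr addr0. Qed.

Lemma comonotonic_sym Z V : comonotonic Z V -> comonotonic V Z.
Proof. by move=> h w w'; rewrite mulrC. Qed.

Lemma comonotonicZr (a : R) Z V : 0 <= a ->
  comonotonic Z V -> comonotonic Z (fun x => a * V x).
Proof. by move=> a0 h w w'; rewrite -mulrBr mulrCA mulr_ge0. Qed.

Lemma L1dist_addr Z (e : R) : L1dist P Z (fun x => Z x + e) = `|e|%:E.
Proof.
rewrite /L1dist (eq_integral (cst `|e|%:E)); last first.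
  by move=> x _ /=; rewrite opprD addrA subrr add0r normrN.
by rewrite integral_cst// [X in (_ * X)%E]probability_setT mule1.
Qed.

Lemma L1dist_indic_subset A B : measurable A -> measurable B -> A `<=` B ->
  L1dist P \1_A \1_B = (P B - P A)%E /\ L1dist P \1_B \1_A = (P B - P A)%E.
Proof.
move=> mA mB AB.
have e x : `|\1_B x - \1_A x| = \1_(B `\` A) x :> R.
  rewrite !indicE in_setD.
  have [xA|xA] := boolP (x \in A).
    by rewrite (_ : x \in B) ?subrr ?normr0//; move: xA; rewrite !inE; exact: AB.
  by rewrite subr0 andbT ger0_norm.
have i : (\int[P]_x (\1_(B `\` A) x)%:E = P B - P A)%E.
  rewrite integral_indic//; last exact: measurableD.
  rewrite setIT measureD//; last by rewrite ltey_eq fin_num_measure.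
  by rewrite setIC (setIidl AB).
split; rewrite -[RHS]i; apply: eq_integral => x _; last by rewrite e.
by rewrite distrC e.
Qed.

(** The preimage of a set under an indicator is the empty set, the whole space, the event or its
    complement. Through law invariance, the rank of [\1_A] therefore depends on [P A] alone. *)
Lemma same_law_indic A B : measurable A -> measurable B -> P A = P B ->
  same_law P (\1_A : T -> R) \1_B.
Proof.
move=> mA mB PAB S mS; rewrite !preimage_indic.
by case: ifP => _; case: ifP => _ //; rewrite !probability_setC// PAB.
Qed.

End bounded_random_variables.

(** * Sets of prescribed measure in an atomless space *)

Section atomless_probability.
Context {d : measure_display} {T : measurableType d} {R : realType}.
Variable P : probability T R.
Implicit Types A B D : set T.

Lemma fine_probabilityK A : measurable A -> P A = (fine (P A))%:E.
Proof. by move=> mA; rewrite fineK// fin_num_measure. Qed.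

Lemma fine_probability_ge0 A : 0 <= fine (P A).
Proof. exact/fine_ge0/measure_ge0. Qed.

Lemma fine_probability_le1 A : measurable A -> fine (P A) <= 1.
Proof. by move=> mA; rewrite -lee_fin -fine_probabilityK// probability_le1. Qed.

Lemma le_fine_probability A B : measurable A -> measurable B -> A `<=` B ->
  fine (P A) <= fine (P B).
Proof. by move=> mA mB AB; rewrite -lee_fin -!fine_probabilityK// le_measure// inE. Qed.

Lemma fine_probabilityD A B : measurable A -> measurable B -> B `<=` A ->
  fine (P (A `\` B)) = fine (P A) - fine (P B).
Proof.
move=> mA mB BA; rewrite measureD//; last by rewrite ltey_eq fin_num_measure.
by rewrite setIC (setIidl BA) fineB ?fin_num_measure.
Qed.

Lemma fine_probabilityU A B : measurable A -> measurable B ->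
  A `&` B = set0 -> fine (P (A `|` B)) = fine (P A) + fine (P B).
Proof. by move=> mA mB AB; rewrite measureU// fineD ?fin_num_measure. Qed.

Hypothesis P_atomless : atomless P.

(** Of a proper piece of [A] and its complement in [A], one carries at most half of the measure. *)
Lemma atomless_half A : measurable A -> 0 < fine (P A) ->
  exists B, [/\ measurable B, B `<=` A, 0 < fine (P B) &
    fine (P B) <= fine (P A) / 2].
Proof.
move=> mA A0; have [|B [mB BA]] := P_atomless A mA; first by rewrite fine_probabilityK.
rewrite (fine_probabilityK B)// (fine_probabilityK A)// !lte_fin => /andP[B0 BltA].
have [Bh|Bh] := leP (fine (P B)) (fine (P A) / 2); first by exists B.
exists (A `\` B); split; [exact: measurableD|by move=> x []| |];
  rewrite fine_probabilityD//; lra.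
Qed.

Lemma atomless_small A (e : R) : measurable A -> 0 < fine (P A) -> 0 < e ->
  exists B, [/\ measurable B, B `<=` A, 0 < fine (P B) & fine (P B) < e].
Proof.
move=> mA A0 e0.
(* Repeated halving gives geometric decay, but the bound [1 / n.+1] is enough; it survives a halving
   because [n + 2 <= 2 * (n + 1)]. *)
have iter n : exists B, [/\ measurable B, B `<=` A, 0 < fine (P B) &
    fine (P B) * n.+1%:R <= 1].
  elim: n => [|n [B [mB BA B0 Bn]]].
    by exists A; split => //; rewrite mulr1 fine_probability_le1.
  have [C [mC CB C0 CB2]] := atomless_half _ mB B0.
  exists C; split => //; first exact: subset_trans BA.
  have n0 : 0 <= n%:R :> R by [].
  by move: Bn; rewrite -(natr1 n.+1) -(natr1 n); nra.
have [B [mB BA B0 Bn]] := iter (Num.trunc e^-1).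
exists B; split => //; have := truncnS_gt e^-1.
rewrite -(ltr_pM2l e0) mulfV ?gt_eqF// => h.
rewrite -(@ltr_pM2r _ (Num.trunc e^-1).+1%:R)//; exact: le_lt_trans Bn h.
Qed.

(* Sierpinski's theorem: a greedy exhaustion, each step adding a set of at
   least half the largest measure still admissible. *)
Lemma atomless_subset A (p : R) : measurable A -> 0 <= p <= fine (P A) ->
  exists B, [/\ measurable B, B `<=` A & fine (P B) = p].
Proof.
move=> mA /andP[p0 pA].
pose ok B := [/\ measurable B, B `<=` A & fine (P B) <= p].
pose step (X Y : {B | ok B}) := sval X `<=` sval Y /\
  forall D, measurable D -> D `<=` A `\` sval X ->
    fine (P (sval X)) + fine (P D) <= p ->
    fine (P D) <= 2 * (fine (P (sval Y)) - fine (P (sval X))).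
have step_ex X : {Y | step X Y}.
  apply: cid; case: X => X okX; have [mX XA Xp] := okX.
  pose S := [set r | exists D, [/\ measurable D, D `<=` A `\` X,
    fine (P X) + fine (P D) <= p & r = fine (P D)]].
  have S0 : S 0.
    by exists set0; split; rewrite ?measure0 ?addr0//; exact: sub0set.
  have hS : has_sup S.
    split; first by exists 0.
    by exists 1 => r [D [mD _ _ ->]]; exact: fine_probability_le1.
  have ubS : ubound S (sup S) := sup_upper_bound hS.
  have : 0 <= sup S by exact: ubS.
  rewrite le_eqVlt => /predU1P[s0|s0].
    (* Only null sets can still be added, so the exhaustion may stay at [X]. *)
    exists (exist _ X okX); split => //= D mD DA Dp.
    by rewrite subrr mulr0 s0; apply: ubS; exists D.
  have s20 : 0 < sup S / 2 by rewrite divr_gt0.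
  have [_ [D [mD DA Dp ->]] hD] := sup_adherent s20 hS.
  have XD : X `&` D = set0.
    by rewrite -subset0 => x [Xx /DA[]].
  have okXD : ok (X `|` D).
    split; [exact: measurableU| |by rewrite fine_probabilityU].
    by rewrite subUset; split => // x /DA[].
  exists (exist _ _ okXD); split => /=; first exact: subsetUl.
  move=> E mE EA Ep; rewrite fine_probabilityU//.
  have : fine (P E) <= sup S by apply: ubS; exists E.
  by lra.
have ok0 : ok set0 by split; rewrite ?measure0//; exact: sub0set.
have [F [F0 /all_and2[Fsub Fmax]]] := dependent_choice step_ex (exist _ _ ok0).
pose B := \bigcup_n sval (F n).
have okF n := svalP (F n).
have mF n : measurable (sval (F n)) by have [] := okF n.
have mB : measurable B by exact: bigcupT_measurable.
have BA : B `<=` A by move=> x [n _]; have [_ + _] := okF n; apply.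
have Bp : fine (P B) <= p.
  rewrite -lee_fin -fine_probabilityK//.
  have ndF : {homo (fun n => sval (F n)) : n m / (n <= m)%N >-> (n <= m)%O}.
    by apply/nondecreasing_seqP => n; apply/subsetPset; exact: Fsub.
  have cB := @nondecreasing_cvg_mu _ _ _ P _ mF mB ndF.
  rewrite -(cvg_lim _ cB)//; apply: lime_le; first by apply/cvg_ex; exists (P B).
  apply: nearW => n /=; rewrite fine_probabilityK// lee_fin.
  by have [] := okF n.
exists B; split => //; apply/eqP; rewrite eq_le Bp /= leNgt; apply/negP => ltp.
have mAB : measurable (A `\` B) by exact: measurableD.
(* If [P B < p], some [D] of positive measure outside [B] fits into the gap and was thus admissible
   at every stage. Each stage then gained at least half of [P D], so the measures of the [F n] would
   exceed 1. *)
have [||D [mD DAB D0 Dp]] := atomless_small (A `\` B) (p - fine (P B)) mAB.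
- by rewrite fine_probabilityD//; lra.
- by rewrite subr_gt0.
have FB n : fine (P (sval (F n))) <= fine (P B).
  by apply: le_fine_probability => // x Fx; exists n.
have grow n : n%:R * fine (P D) <= 2 * fine (P (sval (F n))).
  elim: n => [|n ih]; first by rewrite mul0r mulr_ge0// fine_probability_ge0.
  have := Fmax n D mD.
  have DF : D `<=` A `\` sval (F n).
    by move=> x /DAB[Ax nBx]; split => // Fx; apply: nBx; exists n.
  have Dle : fine (P (sval (F n))) + fine (P D) <= p.
    by have := FB n; lra.
  by move=> /(_ DF Dle); rewrite -natr1; lra.
have := grow (Num.trunc (2 / fine (P D))).+1.
have := truncnS_gt (2 / fine (P D)); rewrite ltr_pdivrMr// => h1 h2.
have := FB (Num.trunc (2 / fine (P D))).+1.
have := fine_probability_le1 _ mB; move: h1 h2.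
by set k := _%:R; lra.
Qed.

(** The missing mass [p - P A] is taken from the complement of [A]. *)
Lemma atomless_superset A (p : R) : measurable A -> fine (P A) <= p <= 1 ->
  exists B, [/\ measurable B, A `<=` B & fine (P B) = p].
Proof.
move=> mA /andP[Ap p1]; have mAC : measurable (~` A) by exact: measurableC.
have PAC : fine (P (~` A)) = 1 - fine (P A).
  by rewrite -setTD fine_probabilityD// probability_setT.
have [|C [mC CA PC]] := atomless_subset _ (p - fine (P A)) mAC.
  by rewrite PAC; lra.
have AC : A `&` C = set0 by rewrite -subset0 => x [Ax /CA].
exists (A `|` C); split; [exact: measurableU|exact: subsetUl|].
by rewrite fine_probabilityU// PC; lra.
Qed.

End atomless_probability.

(** * Staircase approximation of a real number *)

Section staircase.
Context {R : realType}.
Implicit Types c y : R.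

(* For [- M <= y <= - M + n * dl], this is [y] rounded up to the grid
   [- M + dl * N], shifted by [c + M]. *)
Definition staircase (c M dl : R) (n : nat) (y : R) : R :=
  c + dl * \sum_(i < n) (- M + i%:R * dl < y)%R%:R.

Lemma staircase_full (M dl y : R) n : 0 <= dl -> - M + n%:R * dl < y ->
  \sum_(i < n) (- M + i%:R * dl < y)%R%:R = n%:R :> R.
Proof.
move=> dl0 ny; rewrite (eq_bigr (fun=> 1)) ?sumr_const ?card_ord// => i _.
rewrite (_ : _ < y)//; apply: le_lt_trans ny.
by rewrite lerD2l ler_wpM2r// ler_nat ltnW.
Qed.

(** Induction on the number of thresholds: if [y] does not exceed the last one, that term vanishes;
    otherwise every term is 1 and [y] lies in the last cell, of length [dl]. *)
Lemma staircase_approx (c M dl y : R) n : 0 <= dl ->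
  - M <= y <= - M + n%:R * dl ->
  y + (c + M) <= staircase c M dl n y <= y + (c + M) + dl.
Proof.
rewrite /staircase => dl0 /andP[yM]; elim: n => [|n ih].
  by rewrite mul0r big_ord0; lra.
have [yn _|ny] := leP y (- M + n%:R * dl).
  by rewrite big_ord_recr /= ltNge yn addr0; exact: ih.
rewrite big_ord_recr /= ny staircase_full// -natr1 /=; lra.
Qed.

End staircase.

(** * Quantile functions *)

Section quantile.
Context {d : measure_display} {T : measurableType d} {R : realType}.
Variable P : probability T R.
Variables (Z : T -> R) (M : R).
Hypothesis mZ : measurable_fun setT Z.
Hypothesis ZM : forall x, `|Z x| <= M.

Lemma measurable_sublevel (t : R) : measurable [set x | Z x <= t].
Proof.
have := mZ measurableT _ (measurable_itv `]-oo, t]).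
by rewrite setTI; congr measurable.
Qed.

Lemma measurable_superlevel (t : R) : measurable [set x | t < Z x].
Proof.
have := measurableC (measurable_sublevel t); congr measurable.
by apply/seteqP; split => x /=; [move/negP; rewrite -ltNge|rewrite ltNge => /negP].
Qed.

(** The Galois connection between quantile and distribution function. It rests on the infimum being
    attained, that is, on right continuity of the distribution function, obtained from continuity of
    [P] along decreasing sets. The bound [p <= 1] makes [S] nonempty and [0 < p] bounds it below. *)
Lemma quantile_le (p t : R) : 0 < p <= 1 ->
  (quantile P Z p <= t) = (p <= fine (P [set x | Z x <= t])).
Proof.
move=> /andP[p0 p1]; pose S := [set t : R | (p%:E <= Defs.cdf P Z t)%E].
have SE u : S u <-> p <= fine (P [set x | Z x <= u]).
  by rewrite /S /= /Defs.cdf [X in (_ <= X)%E]fine_probabilityK ?lee_fin//;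
    exact: measurable_sublevel.
have up u v : u <= v -> S u -> S v.
  move=> uv /SE Su; apply/SE; apply: le_trans Su _.
  apply: le_fine_probability; try exact: measurable_sublevel.
  by move=> x /= /le_trans; apply.
have SM : S M.
  apply/SE; rewrite (_ : [set x | _] = setT) ?probability_setT//.
  apply/seteqP; split => x //= _.
  by have := ZM x; rewrite ler_norml => /andP[].
have lbS : lbound S (- M).
  move=> u /SE pu; rewrite leNgt; apply/negP => uM; move: pu.
  rewrite (_ : [set x | _] = set0) ?measure0 /=; first by rewrite leNgt p0.
  rewrite -subset0 => x /= Zu; have := ZM x; rewrite ler_norml => /andP[].
  by lra.
have hS : has_inf S by split; [exists M|exists (- M)].
rewrite /quantile -/S; apply/idP/idP => [St|/SE St]; last exact: (ge_inf hS.2).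
apply/SE; apply: (up _ _ St); rewrite /S /= /Defs.cdf.
(* Each [F n] has measure at least [p], since some element of [S] lies below [inf S + n.+1%:R^-1];
   the bound passes to the intersection. *)
pose F n := [set x | Z x <= inf S + n.+1%:R^-1].
have capF : \bigcap_n F n = [set x | Z x <= inf S].
  apply/seteqP; split => x /=; last first.
    by move=> Zx n _; rewrite /F /= (le_trans Zx)// lerDl.
  move=> Fx; apply/ler_addgt0Pr => e e0.
  have [n ne] : exists n, n.+1%:R^-1 < e.
    exists (Num.trunc e^-1); rewrite invf_plt ?posrE//; exact: truncnS_gt.
  by rewrite (le_trans (Fx n I))// lerD2l ltW.
have mF n : measurable (F n) by exact: measurable_sublevel.
have niF : {homo F : n m / (n <= m)%N >-> (m <= n)%O}.
  move=> n m nm; apply/subsetPset => x /= /le_trans; apply.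
  by rewrite lerD2l lef_pV2 ?posrE// ler_nat.
have mcap : measurable (\bigcap_n F n) by rewrite capF; exact: measurable_sublevel.
have PF : (P (F 0%N) < +oo)%E by rewrite ltey_eq fin_num_measure.
have cF := @nonincreasing_cvg_mu _ _ _ P F PF mF mcap niF.
rewrite -capF -(cvg_lim _ cF)//; apply: lime_ge.
  by apply/cvg_ex; exists (P (\bigcap_n F n)).
apply: nearW => n /=.
have n0 : 0 < n.+1%:R^-1 :> R by [].
have [u Su ule] := inf_adherent n0 hS.
exact: up (ltW ule) Su.
Qed.

Lemma quantile_bounded (p : R) : 0 < p <= 1 -> `|quantile P Z p| <= M.
Proof.
move=> p01; rewrite ler_norml; apply/andP; split; last first.
  rewrite quantile_le// (_ : [set x | _] = setT).
    by rewrite probability_setT; case/andP: p01.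
  apply/seteqP; split => x //= _.
  by have := ZM x; rewrite ler_norml => /andP[].
rewrite leNgt; apply/negP => qM; have := lexx (quantile P Z p).
rewrite [X in is_true X -> _]quantile_le// (_ : [set x | _] = set0).
  by rewrite measure0 /= leNgt; case/andP: p01 => ->.
rewrite -subset0 => x /= Zq; have := ZM x; rewrite ler_norml => /andP[].
by lra.
Qed.

End quantile.

(** * Integrals of finite sums of indicators *)

Section integral_staircase.
Context {d : measure_display} {T : measurableType d} {R : realType}.
Variable mu : {measure set T -> \bar R}.
Variables (D : set T) (mD : measurable D) (finD : (mu D < +oo)%E).

Lemma integrable_bounded_in (f : T -> R) (M : R) : measurable_fun D f ->
  (forall x, D x -> `|f x| <= M) -> mu.-integrable D (EFin \o f).
Proof.
move=> mf fM; apply: measurable_bounded_integrable => //.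
exists M; split; first exact: num_real.
by move=> N MN x Dx; exact: le_trans (fM x Dx) (ltW MN).
Qed.

(** Integrability is proved along with the value because additivity of the integral requires it in
    the induction step. *)
Lemma integral_sum_indic (c dl : R) n (E : nat -> set T) :
  (forall i, measurable (E i)) -> (forall i, E i `<=` D) ->
  mu.-integrable D (EFin \o (fun x => c + dl * \sum_(i < n) \1_(E i) x)) /\
  (\int[mu]_(x in D) (c + dl * \sum_(i < n) \1_(E i) x)%:E =
   (c * fine (mu D) + dl * \sum_(i < n) fine (mu (E i)))%:E)%E.
Proof.
move=> mE ED.
have fin A : measurable A -> A `<=` D -> mu A \is a fin_num.
  move=> mA AD; rewrite ge0_fin_numE//; apply: le_lt_trans finD.
  by rewrite le_measure ?inE.
elim: n => [|n [ihi ihe]].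
  have -> : (fun x => c + dl * \sum_(i < 0) \1_(E i) x) = cst c :> (T -> R).
    by apply/funext => x; rewrite big_ord0 mulr0 addr0.
  split; first by apply: (@integrable_bounded_in _ `|c|) => //; exact: measurable_cst.
  rewrite (eq_integral (cst c%:E)); last first.
    by move=> x _; rewrite big_ord0 mulr0 addr0.
  by rewrite integral_cst// big_ord0 mulr0 addr0 EFinM fineK// fin.
pose f (x : T) : R := c + dl * \sum_(i < n) \1_(E i) x.
pose h (x : T) : R := dl * \1_(E n) x.
have ih : mu.-integrable D (EFin \o h).
  apply: (@integrable_bounded_in _ `|dl|).
    by apply: measurable_funM => //; exact: measurable_indic.
  by move=> x _; rewrite /h indicE; case: (x \in E n); rewrite ?mulr1 ?mulr0 ?normr0.
have recE x : c + dl * \sum_(i < n.+1) \1_(E i) x = f x + h x.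
  by rewrite big_ord_recr /= mulrDr addrA.
split.
  rewrite (_ : (fun x => _) = (fun x => f x + h x)); last exact/funext.
  exact: (@integrableD _ _ _ mu D mD _ _ ihi ih).
rewrite (eq_integral (fun x => (EFin \o f) x + (EFin \o h) x)%E); last first.
  by move=> x _; rewrite recE.
rewrite integralD_EFin// [X in (X + _)%E]ihe.
rewrite (eq_integral (fun x => dl%:E * (\1_(E n) x)%:E)%E (EFin \o h))//.
rewrite integralZl//; last first.
  apply: (@integrable_bounded_in _ 1); first exact: measurable_indic.
  by move=> x _; rewrite indicE; case: (x \in E n); rewrite ?normr1 ?normr0.
rewrite integral_indic// (setIidl (ED n)) -[mu (E n)]fineK ?fin//.
by rewrite -EFinM -EFinD big_ord_recr /= mulrDr addrA.
Qed.

End integral_staircase.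

(** * The Stieltjes integral of the quantile function *)

Section dual_utility.
Context {d : measure_display} {T : measurableType d} {R : realType}.
Variable P : probability T R.
Variable w : cumulative R R.
Local Notation mu := (lebesgue_stieltjes_measure w).

Lemma lebesgue_stieltjes_measure_ocitv (a b : R) : a <= b ->
  mu `]a, b]%classic = (w b - w a)%:E.
Proof.
move=> ab; rewrite /lebesgue_stieltjes_measure /measure_extension/=.
by rewrite measurable_mu_extE/= ?wlength_itv_bnd//; exact: is_ocitv.
Qed.

Variables (Z : T -> R) (M : R).
Hypothesis mZ : measurable_fun setT Z.
Hypothesis ZM : forall x, `|Z x| <= M.

(** The point 0 is left out: there the set defining the quantile is all of [R]. *)
Let D : set R := `]0%R, 1%R]%classic.

Let DE p : D p -> 0 < p <= 1.
Proof. by rewrite /D /= in_itv. Qed.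

(** By [quantile_le], the quantile exceeds [t] on [D] exactly on the interval from [F_Z t]
    (excluded) to 1. *)
Lemma measurable_quantile : measurable_fun (D : set (measurableTypeR R)) (quantile P Z).
Proof.
move=> mD; apply: (measurability _ (RGenOInfty.measurableE R)) => //.
move=> /= _ [_ [t ->] <-].
rewrite (_ : _ `&` _ = `]fine (P [set x | Z x <= t]), 1]%classic).
  exact: measurable_itv.
apply/seteqP; split => p /=; rewrite !in_itv /= ?andbT.
  by move=> [p01]; rewrite ltNge (quantile_le P Z M)// -ltNge => ->; case/andP: p01.
move=> /andP[Fp p1]; have p01 : 0 < p <= 1.
  by rewrite p1 andbT; apply: le_lt_trans Fp; exact: fine_probability_ge0.
by split => //; rewrite ltNge (quantile_le P Z M)// -ltNge.
Qed.

Let mD : measurable (D : set (measurableTypeR R)).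
Proof. exact: measurable_itv. Qed.

Let finD : (mu D < +oo)%E.
Proof. by rewrite lebesgue_stieltjes_measure_ocitv// ltry. Qed.

Lemma integrable_quantile : mu.-integrable D (EFin \o quantile P Z).
Proof.
apply: (@integrable_bounded_in _ _ _ mu _ mD finD _ M) => //.
  exact: measurable_quantile.
by move=> p /DE p01; exact: quantile_bounded.
Qed.

Lemma dual_utility_fin_num : dual_utility P w Z \is a fin_num.
Proof. by apply: integrable_fin_num => //; exact: integrable_quantile. Qed.

(** The sum is the exact integral of the staircase of the quantile: its [i]-th step is the indicator
    of [E i], whose mass is an increment of [w]. The error is [dl] times the total mass of [D]. *)
Lemma dual_utility_staircase (dl : R) n : 0 <= dl -> 2 * M = n%:R * dl ->
  `|fine (dual_utility P w Z) - (- M * (w 1 - w 0) + dl *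
    \sum_(i < n) (w 1 - w (fine (P [set x | Z x <= - M + i%:R * dl]))))| <=
  dl * (w 1 - w 0).
Proof.
move=> dl0 Mn.
set S := dl * \sum_(i < n) _.
pose E i : set R := `]fine (P [set x | Z x <= - M + i%:R * dl]), 1]%classic.
have mS (t : R) := measurable_sublevel Z mZ t.
have F01 t : 0 <= fine (P [set x | Z x <= t]) <= 1.
  by rewrite fine_probability_ge0 fine_probability_le1.
have mE i : measurable (E i : set (measurableTypeR R)) by exact: measurable_itv.
have ED i : E i `<=` D.
  move=> p; rewrite /E /D /= !in_itv /= => /andP[Fp ->]; rewrite andbT.
  by apply: le_lt_trans Fp; exact: fine_probability_ge0.
have muD : fine (mu D) = w 1 - w 0 by rewrite lebesgue_stieltjes_measure_ocitv.
have muE i : fine (mu (E i)) = w 1 - w (fine (P [set x | Z x <= - M + i%:R * dl])).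
  by rewrite lebesgue_stieltjes_measure_ocitv//; case/andP: (F01 (- M + i%:R * dl)).
have int c := @integral_sum_indic _ (measurableTypeR R) R mu
    D mD finD c dl n E mE ED.
have stairE c p : D p -> c + dl * \sum_(i < n) \1_(E i) p =
    staircase c M dl n (quantile P Z p).
  move=> /DE p01; congr (_ + _ * _); apply: eq_bigr => i _.
  rewrite indicE ltNge (quantile_le P Z M)// -ltNge; congr ((nat_of_bool _)%:R).
  apply/idP/idP; rewrite inE /E /= in_itv /=; first by case/andP.
  by move=> ->; case/andP: p01.
have appr c p : D p -> quantile P Z p + (c + M) <=
    c + dl * \sum_(i < n) \1_(E i) p <= quantile P Z p + (c + M) + dl.
  move=> Dp; rewrite stairE//; apply: staircase_approx => //.
  have := quantile_bounded P Z M mZ ZM p (DE _ Dp).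
  by rewrite ler_norml => /andP[]; lra.
have S_eq c : (\int[mu]_(x in D) (c + dl * \sum_(i < n) \1_(E i) x)%:E =
    (c * (w 1 - w 0) + S)%:E)%E.
  rewrite (int c).2 muD /S; congr (_ + _ * _)%:E.
  by apply: eq_bigr => i _; rewrite muE.
(* Based at [- M] the staircase lies above the quantile; lowered by [dl] it lies below. *)
have upper : (dual_utility P w Z <= (- M * (w 1 - w 0) + S)%:E)%E.
  rewrite -S_eq; apply: le_integral => //; first exact: integrable_quantile.
    exact: (int _).1.
  by move=> p; rewrite inE => Dp; rewrite lee_fin; have := appr (- M) p Dp; lra.
have lower : (((- M - dl) * (w 1 - w 0) + S)%:E <= dual_utility P w Z)%E.
  rewrite -S_eq; apply: le_integral => //; last 1 first.
  - move=> p; rewrite inE => Dp; rewrite lee_fin.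
    by have := appr (- M - dl) p Dp; lra.
  - exact: (int _).1.
  - exact: integrable_quantile.
move: upper lower; rewrite -(fineK dual_utility_fin_num) !lee_fin => upper lower.
by rewrite ler_norml; apply/andP; split; lra.
Qed.

Lemma dual_utility0 : w 1 = w 0 -> dual_utility P w Z = 0%E.
Proof.
move=> w01.
have mu0 : mu D = 0%E by rewrite lebesgue_stieltjes_measure_ocitv// w01 subrr.
apply: null_set_integral; [exact: mD| |exact: mu0].
by apply/measurable_EFinP; exact: measurable_quantile.
Qed.

End dual_utility.

(** * The preference order on constants and its certainty equivalents *)

Section certainty_equivalent.
Context {d : measure_display} {T : measurableType d} {R : realType}.
Variable P : probability T R.
Variable pref : (T -> R) -> (T -> R) -> Prop.
Hypothesis pref_total : total_preorder_on_Z pref.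
Hypothesis pref_law : law_invariant P pref.
Hypothesis pref_cont : pref_continuous P pref.
Hypothesis pref_mono : pref_monotonic P pref.
Implicit Types (Z V W : T -> R) (A B : set T).

Let pref_trans Z V W : bounded_rv Z -> bounded_rv V -> bounded_rv W ->
  pref Z V -> pref V W -> pref Z W.
Proof. by have [_ + _] := pref_total; apply. Qed.

Lemma pref_le Z V : bounded_rv Z -> bounded_rv V ->
  (forall x, V x <= Z x) -> pref Z V.
Proof.
by move=> bZ bV VZ; apply: pref_mono => //; apply: aeW => x; exact: VZ.
Qed.

Lemma sprefP Z V : bounded_rv Z -> bounded_rv V ->
  spref pref Z V <-> ~ pref V Z.
Proof.
move=> bZ bV; split=> [[]//|nVZ]; split => //.
by have [_ _ /(_ _ _ bZ bV)[]] := pref_total.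
Qed.

Lemma pref_spref_trans Z V W : bounded_rv Z -> bounded_rv V -> bounded_rv W ->
  spref pref Z V -> pref V W -> spref pref Z W.
Proof.
move=> bZ bV bW [ZV nVZ] VW; split; first exact: (pref_trans _ V).
by move=> WZ; apply: nVZ; exact: (pref_trans _ W).
Qed.

(** Monotonicity places [Z] above a constant and [V] below another one. *)
Lemma pref_trivial : (forall c c' : R, pref (cst c) (cst c')) ->
  forall Z V, bounded_rv Z -> bounded_rv V -> pref Z V.
Proof.
move=> triv Z V bZ bV; have [_ [M hM]] := bZ; have [_ [N hN]] := bV.
apply: (pref_trans _ (cst (- M))) => //; first exact: bounded_rv_cst.
  apply: pref_le => //; first exact: bounded_rv_cst.
  by move=> x; have := hM x; rewrite ler_norml => /andP[].
apply: (pref_trans _ (cst N)) => //; try exact: bounded_rv_cst.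
apply: pref_le => //; first exact: bounded_rv_cst.
by move=> x; have := hN x; rewrite ler_norml => /andP[].
Qed.

Hypothesis pref_dual : dual_independence pref.
Hypothesis pref_nontrivial :
  exists c1 c0 : R, spref pref (cst c1) (cst c0).

(** Mixing [c1] and [c0] with a common constant shrinks and translates their gap, which settles
    every gap shorter than [c1 - c0]. Monotonicity extends this to longer gaps. *)
Lemma spref_cst (c c' : R) : c < c' -> spref pref (cst c') (cst c).
Proof.
move=> cc'; have [c1 [c0 c10]] := pref_nontrivial.
have c01 : c0 < c1.
  rewrite ltNge; apply/negP => c10'; apply: (c10.2).
  by apply: pref_le => //; exact: bounded_rv_cst.
have small (e e' : R) : e < e' -> e' - e < c1 - c0 -> spref pref (cst e') (cst e).
  (* The weight [a] scales the gap to [e' - e], and mixing with [(e - a * c0) / (1 - a)] sends [c0]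
     to [e] and [c1] to [e']. *)
  move=> ee' small; pose a := (e' - e) / (c1 - c0).
  have D0 : 0 < c1 - c0 by rewrite subr_gt0.
  have a0 : 0 < a by rewrite divr_gt0 ?subr_gt0.
  have a1 : a < 1 by rewrite ltr_pdivrMr// mul1r.
  have aD : a * (c1 - c0) = e' - e by rewrite mulfVK// gt_eqF.
  have a1' : 1 - a != 0 by rewrite subr_eq0 gt_eqF.
  have b := @bounded_rv_cst _ T R.
  have := pref_dual _ _ (cst ((e - a * c0) / (1 - a))) (b _) (b _) (b _)
    (comonotonic_cstr _ _) (comonotonic_cstr _ _) (comonotonic_cstr _ _) c10 a.
  rewrite a0 a1 => /(_ isT).
  have -> : (fun x : T => a * cst c1 x +
      (1 - a) * cst ((e - a * c0) / (1 - a)) x) = cst e'.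
    by apply/funext => x /=; rewrite [(1 - a) * _]mulrC mulfVK//; lra.
  have -> // : (fun x : T => a * cst c0 x +
      (1 - a) * cst ((e - a * c0) / (1 - a)) x) = cst e.
  by apply/funext => x /=; rewrite [(1 - a) * _]mulrC mulfVK//; lra.
have [|big] := ltP (c' - c) (c1 - c0); first exact: small.
apply/sprefP; [exact: bounded_rv_cst|exact: bounded_rv_cst|move=> cc'p].
(* Were [c] weakly preferred to [c'], it would also be to this intermediate constant, against the
   short-gap case. *)
have [||_] := small c (c + (c1 - c0) / 2); [lra|lra|apply].
apply: (pref_trans _ (cst c')) => //; try exact: bounded_rv_cst.
by apply: pref_le => [||x /=]; [exact: bounded_rv_cst|exact: bounded_rv_cst|lra].
Qed.

(** Dual independence applied to the constants [2 * e] and 0, mixed with [2 * Z] at weight one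
    half. *)
Lemma spref_addr Z (e : R) : bounded_rv Z -> 0 < e ->
  spref pref (fun x => Z x + e) Z.
Proof.
move=> bZ e0; have b := @bounded_rv_cst _ T R.
have e20 : 0 < 2 * e by lra.
have := pref_dual _ _ _ (b _) (b _) (bounded_rvZ 2 _ bZ) (comonotonic_cstr _ _)
  (comonotonic_cstl _ _) (comonotonic_cstl _ _) (spref_cst _ _ e20) 2^-1.
have -> : (fun x : T => 2^-1 * cst (2 * e) x + (1 - 2^-1) * (2 * Z x)) =
   (fun x => Z x + e) by apply/funext => x /=; lra.
have -> : (fun x : T => 2^-1 * cst 0 x + (1 - 2^-1) * (2 * Z x)) = Z.
  by apply/funext => x /=; lra.
by apply; lra.
Qed.

(* The axiom only concerns the strict preference; the weak one follows by
   perturbing [Z] into [Z + e] and letting [e] tend to 0. *)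
Lemma weak_dual_independence Z V W (a : R) : bounded_rv Z -> bounded_rv V ->
  bounded_rv W -> comonotonic Z V -> comonotonic Z W -> comonotonic V W ->
  0 < a < 1 -> pref Z V ->
  pref (fun x => a * Z x + (1 - a) * W x) (fun x => a * V x + (1 - a) * W x).
Proof.
move=> bZ bV bW cZV cZW cVW a01 ZV.
have bmix X : bounded_rv X -> bounded_rv (fun x => a * X x + (1 - a) * W x).
  by move=> bX; apply: bounded_rvD; exact: bounded_rvZ.
apply: ((pref_cont _ (bmix _ bV)).1 _ (bmix _ bZ) _).2 => e e0.
have bZe : bounded_rv (fun x => Z x + e).
  by apply: bounded_rvD => //; exact: bounded_rv_cst.
have eqmix : (fun x => a * (Z x + e) + (1 - a) * W x) =
             (fun x => (a * Z x + (1 - a) * W x) + a * e).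
  by apply/funext => x; lra.
exists (fun x => a * (Z x + e) + (1 - a) * W x).
split; [split; [exact: bmix|]|split; [exact: bmix|]].
  have cs X : comonotonic Z X -> comonotonic (fun x => Z x + e) X.
    move=> cZX; apply: comonotonic_sym; apply: comonotonic_addcr.
    exact: comonotonic_sym.
  have ZeV : spref pref (fun x => Z x + e) V.
    by apply: (pref_spref_trans _ Z) => //; exact: spref_addr.
  exact: (pref_dual _ _ _ bZe bV bW (cs _ cZV) (cs _ cZW) cVW ZeV _ a01).1.
rewrite eqmix L1dist_addr lte_fin ger0_norm; case/andP: a01; nra.
Qed.

Definition certainty_equivalent Z : R := sup [set c | pref Z (cst c)].
Local Notation CE := certainty_equivalent.

(** The supremum is a limit of constants to which [Z] is preferred, and of larger constants, which
    by totality are preferred to [Z]. Both upper and lower sets are closed. *)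
Lemma certainty_equivalentP Z : bounded_rv Z ->
  pref Z (cst (CE Z)) /\ pref (cst (CE Z)) Z.
Proof.
move=> bZ; have b := @bounded_rv_cst _ T R.
have [_ [M hM]] := bZ.
have hs : has_sup [set c | pref Z (cst c)].
  split.
    exists (- M); apply: pref_le => // x.
    by have := hM x; rewrite ler_norml => /andP[].
  exists M => c /= Zc; rewrite leNgt; apply/negP => /spref_cst[_]; apply.
  apply: (pref_trans _ Z) => //; apply: pref_le => // x.
  by have := hM x; rewrite ler_norml => /andP[].
have dist (c e : R) : L1dist P (cst c : T -> R) (cst e) = `|e - c|%:E.
  rewrite -(L1dist_addr P (cst c)); congr (L1dist P _ _).
  by apply/funext => x /=; rewrite addrC subrK.
split.
  apply: ((pref_cont _ bZ).2 _ (b _) _).2 => e e0.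
  have [c /= Zc ec] := sup_adherent e0 hs.
  exists (cst c); split=> //; split=> //; rewrite dist lte_fin.
  have cs : c <= CE Z by apply: sup_upper_bound.
  by rewrite ler0_norm ?subr_le0// opprB ltrBlDr -ltrBlDl.
apply: ((pref_cont _ bZ).1 _ (b _) _).2 => e e0.
exists (cst (CE Z + e / 2)); split; last first.
  by split=> //; rewrite dist lte_fin ger0_norm; lra.
split=> //; have [_ _ /(_ _ _ bZ (b (CE Z + e / 2)))[]//Zc] := pref_total.
have /(_ _ Zc) : ubound [set c | pref Z (cst c)] (CE Z) := sup_upper_bound hs.
by lra.
Qed.

Lemma pref_certainty_equivalent Z V : bounded_rv Z -> bounded_rv V ->
  pref Z V <-> CE V <= CE Z.
Proof.
move=> bZ bV; have b := @bounded_rv_cst _ T R.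
have [Z1 Z2] := certainty_equivalentP _ bZ.
have [V1 V2] := certainty_equivalentP _ bV.
split=> [ZV|VZ].
  rewrite leNgt; apply/negP => /spref_cst[_]; apply.
  by apply: (pref_trans _ Z) => //; apply: (pref_trans _ V).
apply: (pref_trans _ (cst (CE Z))) => //; apply: (pref_trans _ (cst (CE V))) => //.
exact: pref_le.
Qed.

Lemma certainty_equivalent_unique Z (c : R) : bounded_rv Z ->
  pref Z (cst c) -> pref (cst c) Z -> CE Z = c.
Proof.
move=> bZ Zc cZ; have b := @bounded_rv_cst _ T R.
have [Z1 Z2] := certainty_equivalentP _ bZ.
apply/eqP; rewrite eq_le !leNgt; apply/andP; split; apply/negP => /spref_cst[_];
  by apply; apply: (pref_trans _ Z).
Qed.

Lemma certainty_equivalent_cst (c : R) : CE (cst c) = c.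
Proof.
have b := @bounded_rv_cst _ T R.
by apply: certainty_equivalent_unique => //; exact: pref_le.
Qed.

Lemma le_certainty_equivalent Z V : bounded_rv Z -> bounded_rv V ->
  (forall x, Z x <= V x) -> CE Z <= CE V.
Proof. by move=> bZ bV ZV; apply/pref_certainty_equivalent => //; exact: pref_le. Qed.

Lemma certainty_equivalent_same_law Z V : bounded_rv Z -> bounded_rv V ->
  same_law P Z V -> CE Z = CE V.
Proof.
move=> bZ bV /pref_law[]// ZV VZ; apply/eqP; rewrite eq_le.
by apply/andP; split; apply/pref_certainty_equivalent.
Qed.

(** [Z] and then [W] are replaced by their certainty equivalents. Constants are comonotonic with
    everything, so only [Z] and [W] need an assumption. *)
Lemma certainty_equivalent_mix Z W (a : R) : bounded_rv Z -> bounded_rv W ->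
  comonotonic Z W -> 0 < a < 1 ->
  CE (fun x => a * Z x + (1 - a) * W x) = a * CE Z + (1 - a) * CE W.
Proof.
move=> bZ bW cZW a01; have b := @bounded_rv_cst _ T R.
have a01' : 0 < 1 - a < 1 by case/andP: a01; lra.
have [Z1 Z2] := certainty_equivalentP _ bZ.
have [W1 W2] := certainty_equivalentP _ bW.
have c1 := @comonotonic_cstl _ T R; have c2 := @comonotonic_cstr _ T R.
have bmix X Y : bounded_rv X -> bounded_rv Y ->
    bounded_rv (fun x => a * X x + (1 - a) * Y x).
  by move=> bX bY; apply: bounded_rvD; exact: bounded_rvZ.
have mixE : (fun x : T => (1 - a) * cst (CE W) x + (1 - (1 - a)) * cst (CE Z) x) =
  cst (a * CE Z + (1 - a) * CE W) by apply/funext => x /=; lra.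
(* The roles of the two terms are exchanged so that weak independence acts on [W]. *)
have mixWE : (fun x : T => (1 - a) * W x + (1 - (1 - a)) * cst (CE Z) x) =
  (fun x => a * cst (CE Z) x + (1 - a) * W x) by apply/funext => x /=; lra.
apply: certainty_equivalent_unique; first exact: bmix.
  apply: (pref_trans _ (fun x => a * cst (CE Z) x + (1 - a) * W x)) => //;
    [exact: bmix|exact: bmix|exact: weak_dual_independence|].
  by rewrite -mixWE -mixE; exact: weak_dual_independence.
apply: (pref_trans _ (fun x => a * cst (CE Z) x + (1 - a) * W x)) => //;
  [exact: bmix|exact: bmix| |exact: weak_dual_independence].
by rewrite -mixWE -mixE; exact: weak_dual_independence.
Qed.

(** Factors below 1 are mixtures with the constant 0; factors above 1 follow by applying the inverse
    factor to [a * Z]. *)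
Lemma certainty_equivalentZ Z (a : R) : bounded_rv Z -> 0 <= a ->
  CE (fun x => a * Z x) = a * CE Z.
Proof.
have small X (c : R) : bounded_rv X -> 0 < c < 1 ->
    CE (fun x => c * X x) = c * CE X.
  move=> bX c01; have h := certainty_equivalent_mix X (cst 0) c bX
    (bounded_rv_cst _) (comonotonic_cstr _ _) c01.
  have -> : (fun x => c * X x) = (fun x => c * X x + (1 - c) * cst 0 x).
    by apply/funext => x; rewrite mulr0 addr0.
  by rewrite h certainty_equivalent_cst mulr0 addr0.
move=> bZ; rewrite le_eqVlt => /predU1P[<-|a0].
  rewrite mul0r -[RHS]certainty_equivalent_cst; congr (CE _).
  by apply/funext => x; rewrite mul0r.
have [a1|a1|->] := ltgtP a 1; first by apply: small; rewrite // a0 a1.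
- have h : CE (fun x => a^-1 * (a * Z x)) = a^-1 * CE (fun x => a * Z x).
    by apply: small; rewrite ?invr_gt0 ?a0 ?invf_lt1//; exact: bounded_rvZ.
  apply: (@mulfI _ a^-1); first by rewrite invr_neq0// gt_eqF.
  rewrite -h mulKf ?gt_eqF//; congr (CE _); apply/funext => x.
  by rewrite mulKf ?gt_eqF.
- by rewrite mul1r; congr (CE _); apply/funext => x; rewrite mul1r.
Qed.

(** The sum is the even mixture of [2 * Z] and [2 * W]. *)
Lemma certainty_equivalentD Z W : bounded_rv Z -> bounded_rv W ->
  comonotonic Z W -> CE (fun x => Z x + W x) = CE Z + CE W.
Proof.
move=> bZ bW cZW.
have c2 : comonotonic (fun x => 2 * Z x) (fun x => 2 * W x).
  apply: comonotonicZr => //; apply: comonotonic_sym.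
  by apply: comonotonicZr => //; exact: comonotonic_sym.
have := certainty_equivalent_mix _ _ 2^-1 (bounded_rvZ 2 _ bZ)
  (bounded_rvZ 2 _ bW) c2.
rewrite !certainty_equivalentZ// => h.
rewrite [RHS](_ : _ = 2^-1 * (2 * CE Z) + (1 - 2^-1) * (2 * CE W)); last by lra.
by rewrite -h; [congr (CE _); apply/funext => x /=; lra|lra].
Qed.

(** Monotonicity and additivity with respect to the constant [e] yield this Lipschitz bound for the
    uniform norm. *)
Lemma certainty_equivalent_dist Z V (e : R) : bounded_rv Z -> bounded_rv V ->
  (forall x, `|Z x - V x| <= e) -> `|CE Z - CE V| <= e.
Proof.
suff half Z' V' : bounded_rv Z' -> bounded_rv V' ->
    (forall x, `|Z' x - V' x| <= e) -> CE Z' - CE V' <= e.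
  move=> bZ bV h; rewrite ler_norml half// andbT lerNl opprB half// => x.
  by rewrite distrC.
move=> bZ bV h; have be := @bounded_rv_cst _ T R e.
rewrite lerBlDl -[X in _ + X]certainty_equivalent_cst -certainty_equivalentD//;
  last exact: comonotonic_cstr.
apply: le_certainty_equivalent => //; first exact: bounded_rvD.
by move=> x; have := h x; rewrite ler_norml /= => /andP[]; lra.
Qed.

Lemma certainty_equivalent_closed V (c : R) : bounded_rv V ->
  (forall e : R, 0 < e -> exists V', [/\ bounded_rv V',
     (L1dist P V V' < e%:E)%E & c <= CE V']) -> c <= CE V.
Proof.
move=> bV h; have b := @bounded_rv_cst _ T R c.
rewrite -[c]certainty_equivalent_cst; apply/pref_certainty_equivalent => //.
apply: ((pref_cont _ b).1 _ bV _).2 => e /h[V' [bV' VV' cV']].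
exists V'; split=> //; split=> //.
by apply/pref_certainty_equivalent => //; rewrite certainty_equivalent_cst.
Qed.

Lemma certainty_equivalent_coclosed V (c : R) : bounded_rv V ->
  (forall e : R, 0 < e -> exists V', [/\ bounded_rv V',
     (L1dist P V V' < e%:E)%E & CE V' <= c]) -> CE V <= c.
Proof.
move=> bV h; have b := @bounded_rv_cst _ T R c.
rewrite -[c]certainty_equivalent_cst; apply/pref_certainty_equivalent => //.
apply: ((pref_cont _ b).2 _ bV _).2 => e /h[V' [bV' VV' cV']].
exists V'; split=> //; split=> //.
by apply/pref_certainty_equivalent => //; rewrite certainty_equivalent_cst.
Qed.

Lemma bounded_rv_level_sum Z (t : nat -> R) n : bounded_rv Z ->
  bounded_rv (fun x => \sum_(i < n) (t i < Z x)%R%:R : R).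
Proof.
move=> bZ; elim: n => [|n ih].
  rewrite (_ : (fun x => _) = cst 0); first exact: bounded_rv_cst.
  by apply/funext => x; rewrite big_ord0.
rewrite (_ : (fun x => _) = (fun x => \sum_(i < n) (t i < Z x)%R%:R +
    \1_[set x | t n < Z x] x)).
  by apply: bounded_rvD ih _; apply: bounded_rv_indic;
    exact: measurable_superlevel bZ.1 _.
by apply/funext => x; rewrite big_ord_recr indicE /= mem_setE.
Qed.

(** The partial sum and the next indicator are nondecreasing functions of the same [Z], hence
    comonotonic, and additivity applies. *)
Lemma certainty_equivalent_level_sum Z (t : nat -> R) n : bounded_rv Z ->
  CE (fun x => \sum_(i < n) (t i < Z x)%R%:R) =
  \sum_(i < n) CE \1_[set x | t i < Z x].
Proof.
move=> bZ; elim: n => [|n ih].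
  rewrite big_ord0 -[RHS]certainty_equivalent_cst; congr (CE _).
  by apply/funext => x; rewrite big_ord0.
rewrite big_ord_recr /= -ih -certainty_equivalentD; last 3 first.
- exact: bounded_rv_level_sum.
- by apply: bounded_rv_indic; exact: measurable_superlevel bZ.1 _.
- have nd (s : R) : {homo (fun y : R => (s < y)%R%:R : R) : x y / x <= y}.
    by move=> x y xy; rewrite ler_nat; case: ltP => // /lt_le_trans ->.
  rewrite (_ : \1__ = (fun y : R => (t n < y)%R%:R) \o Z); last first.
    by apply/funext => x; rewrite indicE /= mem_setE.
  apply: (@comonotonic_comp _ _ _ Z (fun y => \sum_(i < n) (t i < y)%R%:R)) => //.
  by move=> x y xy; apply: ler_sum => i _; exact: nd.
by congr (CE _); apply/funext => x; rewrite big_ord_recr /= indicE mem_setE.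
Qed.

Lemma certainty_equivalent_staircase Z (M dl : R) n : bounded_rv Z ->
  0 <= dl -> (forall x, `|Z x| <= M) -> 2 * M = n%:R * dl ->
  `|CE Z - (- M + dl * \sum_(i < n) CE \1_[set x | - M + i%:R * dl < Z x])| <= dl.
Proof.
move=> bZ dl0 ZM Mn; pose t i : R := - M + i%:R * dl.
have bS := bounded_rv_level_sum Z t n bZ.
have bdS := bounded_rvZ dl _ bS.
have <- : CE (fun x => cst (- M) x + dl * \sum_(i < n) (t i < Z x)%R%:R) =
    - M + dl * \sum_(i < n) CE \1_[set x | - M + i%:R * dl < Z x].
  rewrite certainty_equivalentD//; last 2 first.
  - exact: bounded_rv_cst.
  - exact: comonotonic_cstl.
  rewrite certainty_equivalent_cst certainty_equivalentZ//.
  by rewrite certainty_equivalent_level_sum.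
apply: certainty_equivalent_dist => // [|x].
  by apply: bounded_rvD => //; exact: bounded_rv_cst.
have := staircase_approx (- M) M dl (Z x) n dl0.
rewrite /staircase addNr addr0 /= => h.
rewrite ler_norml; have := ZM x; rewrite ler_norml => Zx.
have /h : - M <= Z x <= - M + n%:R * dl by lra.
by set s := _ + dl * _; lra.
Qed.

(** * The distortion function and the integral representation *)

Hypothesis P_atomless : atomless P.

(** A [cumulative] function lives on the whole line; the projection onto [[0, 1]] extends the
    distortion by constants. *)
Let clamp (p : R) : R := if p <= 0 then 0 else if 1 <= p then 1 else p.

Let clamp01 p : 0 <= clamp p <= 1.
Proof. by rewrite /clamp; case: (leP p 0) => ?; case: (leP 1 p) => ?; lra. Qed.

Let clamp_lip p q : p <= q -> 0 <= clamp q - clamp p <= q - p.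
Proof.
move=> pq; rewrite /clamp.
by case: (leP p 0) => ?; case: (leP q 0) => ?; case: (leP 1 p) => ?;
  case: (leP 1 q) => ?; lra.
Qed.

(** A set [S p] of measure [1 - clamp p] is chosen for each [p] and [w p] is read off its indicator;
    law invariance makes the choice immaterial. Nested sets give monotonicity, [L1] continuity
    excludes jumps. *)
Lemma distortion_ex : exists w : R -> R,
  [/\ continuous w, {homo w : p q / p <= q},
      (forall p, p <= 0 -> w p = 0), (forall p, 1 <= p -> w p = 1) &
      forall A, measurable A -> CE \1_A = 1 - w (1 - fine (P A))].
Proof.
have PT : fine (P setT) = 1 by rewrite probability_setT.
have /choice[S hS] p : exists S, measurable S /\ fine (P S) = 1 - clamp p.
  have [|B [mB _ PB]] := atomless_subset P P_atomless setT (1 - clamp p) measurableT.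
    by rewrite PT; have := clamp01 p; lra.
  by exists B.
have mS p : measurable (S p) by case: (hS p).
have PS p : fine (P (S p)) = 1 - clamp p by case: (hS p).
have bS A := @bounded_rv_indic _ T R A.
pose w p := 1 - CE \1_(S p).
have CEE A p : measurable A -> fine (P A) = 1 - clamp p -> CE \1_A = 1 - w p.
  move=> mA PA; rewrite /w subKr; apply: certainty_equivalent_same_law; try exact: bS.
  by apply: same_law_indic => //; rewrite (fine_probabilityK P A)// (fine_probabilityK P (S p))// PA PS.
have le_indic A B : measurable A -> measurable B -> A `<=` B ->
    CE \1_A <= CE \1_B.
  move=> mA mB AB; apply: le_certainty_equivalent; try exact: bS.
  move=> x; rewrite !indicE ler_nat; have [xA|//] := boolP (x \in A).
  by rewrite (_ : x \in B)//; move: xA; rewrite !inE; exact: AB.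
have wnd : {homo w : p q / p <= q}.
  move=> p q pq; have := clamp_lip _ _ pq; have := clamp01 p => p01 pq01.
  have [|B [mB SB PB]] := atomless_superset P P_atomless (S q) (1 - clamp p) (mS q).
    by rewrite PS; lra.
  by have := le_indic _ _ (mS q) mB SB; rewrite (CEE B p)//  /w; lra.
have L1S A B (e : R) : measurable A -> measurable B -> A `<=` B ->
    fine (P B) - fine (P A) < e ->
    (L1dist P \1_A \1_B < e%:E)%E /\ (L1dist P \1_B \1_A < e%:E)%E.
  move=> mA mB AB lte; have [-> ->] := L1dist_indic_subset P A B mA mB AB.
  by rewrite (fine_probabilityK P A)// (fine_probabilityK P B)// -EFinB lte_fin.
(* A jump of size [e] to the right of [p] would put the certainty equivalents of subsets arbitrarily
   [L1]-close to [S p] at least [e] below that of [S p]. The left side is symmetric, with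
   supersets. *)
have right_close p (e : R) : 0 < e -> exists2 h, 0 < h & w (p + h) < w p + e.
  move=> e0; apply: contrapT => nh.
  have hw h : 0 < h -> w p + e <= w (p + h).
    by move=> h0; rewrite leNgt; apply/negP => hh; apply: nh; exists h.
  have : CE \1_(S p) <= CE \1_(S p) - e; last by lra.
  apply: certainty_equivalent_coclosed; first exact: bS.
  move=> u u0; have u2 : 0 < u / 2 by lra.
  have [|c1 c2] := andP (@clamp_lip p (p + u / 2) _); first by lra.
  have [|B [mB BS PB]] := atomless_subset P P_atomless (S p) (1 - clamp (p + u / 2)) (mS p).
    by rewrite PS; have := clamp01 (p + u / 2); lra.
  exists \1_B; split; first exact: bS.
    by apply: (L1S B (S p) u mB (mS p) BS _).2; rewrite PB PS; lra.
  by rewrite (CEE B (p + u / 2))//; have := hw _ u2; rewrite {1}/w; lra.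
have left_close p (e : R) : 0 < e -> exists2 h, 0 < h & w p - e < w (p - h).
  move=> e0; apply: contrapT => nh.
  have hw h : 0 < h -> w (p - h) <= w p - e.
    by move=> h0; rewrite leNgt; apply/negP => hh; apply: nh; exists h.
  have : CE \1_(S p) + e <= CE \1_(S p); last by lra.
  apply: certainty_equivalent_closed; first exact: bS.
  move=> u u0; have u2 : 0 < u / 2 by lra.
  have [|c1 c2] := andP (@clamp_lip (p - u / 2) p _); first by lra.
  have [|B [mB BS PB]] := atomless_superset P P_atomless (S p) (1 - clamp (p - u / 2)) (mS p).
    by rewrite PS; have := clamp01 (p - u / 2); lra.
  exists \1_B; split; first exact: bS.
    by apply: (L1S (S p) B u (mS p) mB BS _).1; rewrite PB PS; lra.
  by rewrite (CEE B (p - u / 2))//; have := hw _ u2; rewrite {2}/w; lra.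
exists w; split => //.
- move=> p; apply/cvgrPdist_lt => e e0.
  have [h h0 hw] := right_close p e e0; have [k k0 kw] := left_close p e e0.
  have m0 : 0 < Num.min h k by rewrite lt_min h0.
  near=> q.
  have : `|p - q| < Num.min h k.
    by near: q; exists (Num.min h k).
  rewrite lt_min => /andP[]; rewrite !ltr_norml => qh qk.
  have q1 : w q <= w (p + h) by apply: wnd; lra.
  have q2 : w (p - k) <= w q by apply: wnd; lra.
  by lra.
- move=> p p0; have := CEE setT p measurableT.
  have -> : clamp p = 0 by rewrite /clamp; case: (leP p 0) => ?; case: (leP 1 p) => ?; lra.
  rewrite PT subr0 => /(_ erefl).
  by rewrite indicT certainty_equivalent_cst; lra.
- move=> p p1; have := CEE set0 p measurable0.
  have -> : clamp p = 1 by rewrite /clamp; case: (leP p 0) => ?; case: (leP 1 p) => ?; lra.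
  rewrite measure0 subrr => /(_ erefl).
  by rewrite indic0 certainty_equivalent_cst; lra.
- move=> A mA; apply: CEE => //.
  have -> : clamp (1 - fine (P A)) = 1 - fine (P A); last by rewrite subKr.
  have := fine_probability_ge0 P A; have := fine_probability_le1 P A mA.
  rewrite /clamp; move: (fine (P A)) => r.
  by case: (leP (1 - r) 0) => ?; case: (leP 1 (1 - r)) => ?; lra.
Unshelve. all: by end_near. Qed.

Lemma dual_utility_certainty_equivalent : exists w : cumulative R R,
  [/\ continuous w, forall p, p <= 0 -> w p = 0, forall p, 1 <= p -> w p = 1 &
      forall Z, bounded_rv Z -> dual_utility P w Z = (CE Z)%:E].
Proof.
have [w [cw w00 w01 wE]] : exists w : cumulative R R,
    [/\ continuous w, forall p, p <= 0 -> w p = 0, forall p, 1 <= p -> w p = 1 &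
        forall A, measurable A -> CE \1_A = 1 - w (1 - fine (P A))].
  have [w [cw ndw w0 w1 wE]] := distortion_ex.
  pose c : cumulative R R :=
    HB.pack w (isCumulative.Build R _ R w ndw (right_continuousW cw)).
  by exists c.
exists w; split => // Z bZ; have [mZ [M0 ZM0]] := bZ.
(* The bound is raised to at least 1 to make it positive. *)
pose M := Num.max 1 M0.
have ZM x : `|Z x| <= M by rewrite le_max ZM0 orbT.
have M0' : 0 < M by rewrite lt_max ltr01.
rewrite -[LHS]fineK ?(dual_utility_fin_num P w Z M)//; congr (_%:E).
have close n : `|fine (dual_utility P w Z) - CE Z| <= 4 * M / n.+1%:R.
  pose dl := 2 * M / n.+1%:R.
  have dl0 : 0 <= dl by rewrite divr_ge0 ?mulr_ge0 ?ltW.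
  have Mn : 2 * M = n.+1%:R * dl by rewrite /dl [RHS]mulrC divfK.
  have := dual_utility_staircase P w Z M mZ ZM dl n.+1 dl0 Mn.
  have := certainty_equivalent_staircase Z M dl n.+1 bZ dl0 ZM Mn.
  (* With total mass 1, the certainty equivalent and the integral are both within [dl] of the same
     number. *)
  rewrite (w00 0)// (w01 1)// subr0 !mulr1.
  rewrite (eq_bigr (fun i : 'I_n.+1 =>
    1 - w (fine (P [set x | Z x <= - M + i%:R * dl])))); last first.
    move=> i _; rewrite wE; last exact: measurable_superlevel.
    congr (1 - w _).
    have mle := measurable_sublevel Z mZ (- M + i%:R * dl).
    rewrite (_ : [set x | _ < _] = setT `\` [set x | Z x <= - M + i%:R * dl]).
      by rewrite fine_probabilityD// probability_setT subKr.
    apply/seteqP; split => x /=; first by move=> lt; split => //; apply/negP; rewrite -ltNge.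
    by move=> [_ /negP]; rewrite -ltNge.
  set s := \sum_(i < n.+1) _.
  have -> : 4 * M / n.+1%:R = dl + dl by rewrite /dl; field.
  by rewrite !ler_norml; lra.
apply/eqP; rewrite -subr_eq0 -normr_eq0 eq_le normr_ge0 andbT leNgt; apply/negP.
set r := `|_|; move=> r0.
(* This index makes [4 * M / n.+1%:R] smaller than [r]. *)
have := close (Num.trunc (4 * M / r)); rewrite -/r ler_pdivlMr//.
by have := truncnS_gt (4 * M / r); rewrite ltr_pdivrMr//; lra.
Qed.

End certainty_equivalent.

(** It serves the degenerate case of total indifference, where the utility must be constant. *)
Lemma cumulative_cst0 (R : realType) : exists w : cumulative R R, w = cst 0 :> (R -> R).
Proof.
have nd : {homo (cst 0 : R -> R) : p q / p <= q} by [].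
have cc : continuous (cst 0 : R -> R) by move=> x; exact: cvg_cst.
pose w : cumulative R R := HB.pack (cst 0 : R -> R)
  (isCumulative.Build R _ R (cst 0) nd (right_continuousW cc)).
by exists w.
Qed.

Theorem mainTheorem16 (d : measure_display) (T : measurableType d) (R : realType)
  (P : probability T R) (pref : (T -> R) -> (T -> R) -> Prop) :
  atomless P ->
  total_preorder_on_Z pref ->
  law_invariant P pref ->
  pref_continuous P pref ->
  pref_monotonic P pref ->
  dual_independence pref ->
  exists w : cumulative R R,
    [/\ continuous w /\ {in `[0, 1] &, nondecreasing w},
        (forall p, 0 <= p <= 1 -> 0 <= w p),
        (forall p, p <= 0 -> w p = w 0),
        (forall p, 1 <= p -> w p = w 1)
      & numerical_representation pref (dual_utility P w)].
Proof.
move=> Patom tot law cont mono dual.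
have [nontriv|triv] := pselect (exists c1 c0 : R, spref pref (cst c1) (cst c0)).
  have [w [cw w0 w1 wU]] := dual_utility_certainty_equivalent
    P pref tot law cont mono dual nontriv Patom.
  have ndw : {homo w : p q / p <= q} := cumulative_is_nondecreasing w.
  exists w; split.
  - by split => // p q _ _; exact: ndw.
  - by move=> p /andP[p0 _]; rewrite -(w0 0)// ndw.
  - by move=> p p0; rewrite !w0.
  - by move=> p p1; rewrite !w1.
  - move=> Z V bZ bV; rewrite !wU// lte_fin ltNge.
    rewrite (sprefP pref tot)//.
    rewrite (pref_certainty_equivalent P pref tot cont mono dual nontriv V Z bV bZ).
    by split => /negP.
have {}triv Z V : bounded_rv Z -> bounded_rv V -> pref Z V.
  move=> bZ bV; apply: (pref_trivial P pref tot mono) => // c c'.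
  have b := @bounded_rv_cst _ T R.
  apply: contrapT => npref; apply: triv; exists c', c.
  by apply/(sprefP pref tot).
have [w wE] := cumulative_cst0 R.
exists w; split.
- by rewrite wE; split => // x; exact: cvg_cst.
- by move=> p _; rewrite wE.
- by move=> p _; rewrite wE.
- by move=> p _; rewrite wE.
- move=> Z V bZ bV; have w01 : w 1 = w 0 by rewrite wE.
  have U0 X : bounded_rv X -> dual_utility P w X = 0%E.
    by move=> [mX [M XM]]; exact: (dual_utility0 P w X M).
  rewrite !U0// ltxx; split => [[_ nVZ]|//].
  by exfalso; apply: nVZ; exact: triv.
Qed.
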